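(* Let $p\ge 2$. The inverse $p$-maxian problem on a tree $T$ with prespecified set $S$ of $p$ leaves can be reduced to at most $p^2$ inverse 2-maxian problems on $T$, namely those with prespecified pair $\{a,b\}\subseteq S$ (same tree, weights, lengths, bounds and cost function): an optimal solution of the inverse $p$-maxian problem is obtained as the cheapest among the optimal solutions of these inverse 2-maxian problems.
   Context: Let $T=(V,E)$ be a tree with $|V|=n$, vertex weights $w_i\ge 0$ ($v_i\in V$) and edge lengths $\ell_e\ge 0$ ($e\in E$). A point of $T$ is a vertex or a point in the interior of an edge, and $d$ is the shortest-path distance. A set $X=\{x_1,\ldots,x_p\}$ of $p$ points of $T$ is a $p$-maxian of $T$ if it maximizes $F(X)=\sum_{i=1}^n w_i\max_{1\le j\le p} d(v_i,x_j)$ over all sets of $p$ points of $T$. Inverse $p$-maxian problem: given a prespecified set $S$ of $p$ leaves of $T$, bounds $\bar p_e,\bar q_e\ge 0$ for $e\in E$ and a cost function $\mathcal C(p,q)$, choose $p_e,q_e$ with $0\le p_e\le\bar p_e$ and $0\le q_e\le\bar q_e$, giving new lengths $\tilde\ell_e=\ell_e+p_e-q_e$ that must be non-negative, so that $S$ is a $p$-maxian of $T$ with respect to the lengths $\tilde\ell$ and $\mathcal C(p,q)$ is minimized. The inverse 2-maxian problem is the case of a prespecified pair $\{a,b\}$. *)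

(* Defs.v *)
From mathcomp Require Import all_boot all_order all_algebra.
From mathcomp Require Import finmap.
From mathcomp Require Import boolp classical_sets reals.

Set Implicit Arguments.
Unset Strict Implicit.
Unset Printing Implicit Defensive.

Import Order.TTheory GRing.Theory Num.Theory.

Local Open Scope ring_scope.

(* A finite simple graph, given by its adjacency relation, that is a tree.
   A duplicate-free adj-cycle of size 2 is just an edge traversed back and
   forth, so the cycles of the graph are those of size at least 3. *)
Definition is_tree (V : finType) (adj : rel V) : Prop :=
  [/\ symmetric adj, irreflexive adj,
      forall u v : V, connect adj u v
    & forall c : seq V, (2 < size c)%N -> ~ ucycle adj c].

Definition leaf (V : finType) (adj : rel V) (v : V) : bool :=
  #|[set u | adj v u]%SET| == 1%N.

(* Each undirected edge {u, v} is represented exactly once, by the pair whose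
   first component comes first in the enumeration of V. This orientation only
   serves to name the two ends of an edge. *)
Definition edge (V : finType) (adj : rel V) : Type :=
  {uv : V * V | adj uv.1 uv.2 && (enum_rank uv.1 < enum_rank uv.2)%N}.

Definition joins (V : finType) (adj : rel V) (e : edge adj) (u v : V) : bool :=
  (val e == (u, v)) || (val e == (v, u)).

Section Maxian.
Context {R : realType} {V : finType} {adj : rel V}.
Local Notation E := (edge adj).

Section Distance.
Variable len : E -> R.

(* For adjacent u and v the sum has exactly one term. *)
Definition step_length (u v : V) : R := \sum_(e : E | joins e u v) len e.

Definition walk_length (u : V) (s : seq V) : R :=
  \sum_(r <- pairmap step_length u s) r.

Definition vertex_dist (u v : V) : R :=
  inf [set walk_length u s | s in [set s | path adj u s /\ last u s = v]]%classic.

(* inl v is the vertex v; inr (e, t) is the point of the edge e at distance t,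
   measured along e, from the first end of e. *)
Definition point : Type := (V + E * R)%type.

(* An edge of length zero has no interior points. *)
Definition in_tree (x : point) : bool :=
  match x with
  | inl _ => true
  | inr (e, t) => 0 < t < len e
  end.

Definition dist (v : V) (x : point) : R :=
  match x with
  | inl u => vertex_dist v u
  | inr (e, t) => Num.min (vertex_dist v (val e).1 + t)
                          (vertex_dist v (val e).2 + (len e - t))
  end.

(* Distances are nonnegative, so 0 is a harmless default for the maximum. *)
Definition maxian_value (w : V -> R) (X : {fset point}) : R :=
  \sum_(v : V) w v * \big[Num.max/0]_(x <- X) dist v x.

Definition point_set (k : nat) (X : {fset point}) : Prop :=
  #|` X | = k /\ {in X, forall x, in_tree x}.

Definition is_maxian (w : V -> R) (k : nat) (X : {fset point}) : Prop :=
  point_set k X /\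
  forall Y : {fset point}, point_set k Y -> maxian_value w Y <= maxian_value w X.

End Distance.

Definition vertex_points (S : {set V}) : {fset point} :=
  [fset (inl v : point) | v in S]%fset.

End Maxian.

Arguments point R {V} adj.

(* Everything in an inverse maxian problem on the tree (V, adj) apart from the
   prespecified set. *)
Record inverse_data (R : realType) (V : finType) (adj : rel V) := InverseData {
  weight : V -> R;
  elen : edge adj -> R;
  max_incr : edge adj -> R;
  max_decr : edge adj -> R;
  cost : (edge adj -> R) -> (edge adj -> R) -> R
}.

Definition nonneg_data (R : realType) (V : finType) (adj : rel V)
    (I : inverse_data R adj) : Prop :=
  [/\ forall v, 0 <= weight I v, forall e, 0 <= elen I e,
      forall e, 0 <= max_incr I e & forall e, 0 <= max_decr I e].

Section Inverse.
Context {R : realType} {V : finType} {adj : rel V}.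
Variable I : inverse_data R adj.

(* The increases and the decreases of the edge lengths. *)
Definition modification : Type := ((edge adj -> R) * (edge adj -> R))%type.

Definition new_len (x : modification) (e : edge adj) : R :=
  elen I e + x.1 e - x.2 e.

Definition total_cost (x : modification) : R := cost I x.1 x.2.

Definition inverse_feasible (k : nat) (S : {set V}) (x : modification) : Prop :=
  [/\ forall e, 0 <= x.1 e <= max_incr I e,
      forall e, 0 <= x.2 e <= max_decr I e,
      forall e, 0 <= new_len x e
    & is_maxian (new_len x) (weight I) k (vertex_points S)].

Definition inverse_optimal (k : nat) (S : {set V}) (x : modification) : Prop :=
  inverse_feasible k S x /\
  forall y, inverse_feasible k S y -> total_cost x <= total_cost y.

(* A correct answer to the inverse k-maxian problem: an optimal solution, or
   None when the problem is infeasible. *)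
Definition solves (k : nat) (S : {set V}) (o : option modification) : Prop :=
  match o with
  | Some x => inverse_optimal k S x
  | None => ~ exists x, inverse_feasible k S x
  end.

Definition pairs_in (S : {set V}) : {set {set V}} :=
  [set A : {set V} | (A \subset S) && (#|A| == 2)]%SET.

(* o is a cheapest solution among the answers sol A, A in P; it is None when
   none of these answers is a solution. *)
Definition cheapest (P : {set {set V}}) (sol : {set V} -> option modification)
    (o : option modification) : Prop :=
  match o with
  | Some x => (exists2 A, A \in P & sol A = Some x) /\
              forall B y, B \in P -> sol B = Some y ->
                total_cost x <= total_cost y
  | None => forall B, B \in P -> sol B = None
  end.

End Inverse.

(* Main.v *)
Require Import Defs.
From mathcomp Require Import all_boot all_order all_algebra.
From mathcomp Require Import finmap.
From mathcomp Require Import boolp classical_sets reals.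
From mathcomp Require Import lra.

(** Everything rests on one property of tree metrics: if s and t are two
    vertices of a set A at maximal distance from each other, then every vertex v
    has either s or t as a farthest point of A ([diametral_pair]). The reason
    is that the paths between v, s and t meet in a median m; a vertex x of A
    is separated by m from s or from t, so it cannot be farther from m than
    the other one of them without contradicting the maximality of d(s, t).
    Going through m, it cannot be farther from v than both s and t either.

    Applied to S, this gives a pair of elements of S with the same objective
    value as S. Applied to the set of all vertices, it gives a pair of vertices
    whose value bounds that of every set of points of the tree, interior points
    of edges included, because the distance from a vertex to a point of an edge
    is at most its distance to one of the two ends. Hence the largest value over
    k points is the same for all k from 2 to the number of vertices, and for
    fixed edge lengths S is a p-maxian if and only if some pair contained in S
    is a 2-maxian ([maxian_iff_pair]).

    So the feasible set of the inverse p-maxian problem is the union of the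
    feasible sets of the inverse 2-maxian problems over the pairs in S, with
    the same cost, and minimizing over a finite union amounts to
    taking the best of the minima ([cheapest_solves], [optimal_cheapest]). *)

Set Implicit Arguments.
Unset Strict Implicit.
Unset Printing Implicit Defensive.

Import Order.TTheory GRing.Theory Num.Theory.

(** * Separation of vertices in a tree *)

Section Linked.
Variables (V : finType) (adj : rel V).

(** This is connectedness in the graph with m deleted: [~~ linked m x y] says
    that m lies on every walk from x to y. In particular [linked m m y] is
    false, so that m separates itself from every vertex. *)
Definition linked (m x y : V) : bool :=
  (x != m) && connect [rel u v | [&& u != m, v != m & adj u v]] x y.

Lemma linked_refl m x : linked m x x = (x != m).
Proof. by rewrite /linked connect0 andbT. Qed.

Lemma linked_trans m : transitive (linked m).
Proof.
move=> y x z /andP[xm xy] /andP[_ yz].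
by rewrite /linked xm (connect_trans xy yz).
Qed.

Lemma linked_adj m x y : x != m -> y != m -> adj x y -> linked m x y.
Proof. by move=> xm ym xy; rewrite /linked xm connect1 //= xm ym. Qed.

Lemma linked_path m x p :
  path adj x p -> m \notin x :: p -> linked m x (last x p).
Proof.
elim: p x => [|y p IHp] x /=; first by rewrite inE eq_sym linked_refl.
case/andP=> xy yp; rewrite inE negb_or eq_sym => /andP[xm mp].
apply: linked_trans (IHp y yp mp); apply: linked_adj => //.
by apply: contraNneq mp => ->; rewrite mem_head.
Qed.

Lemma linkedP m x y : linked m x y ->
  exists p, [/\ path adj x p, uniq (x :: p), last x p = y & m \notin x :: p].
Proof.
case/andP=> xm /connectP[q xq ->]; case/shortenP: xq => p xp up _.
exists p; split=> //.
  by apply: sub_path xp => u v /and3P[].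
rewrite inE negb_or eq_sym xm /=.
elim: p x xp {up xm} => //= z p IHp x /andP[/and3P[_ zm _] zp].
by rewrite inE negb_or eq_sym zm (IHp z zp).
Qed.

Lemma linked_neqr m x y : linked m x y -> y != m.
Proof.
case/linkedP=> p [_ _ <- mp].
by apply: contraNneq mp => <-; rewrite mem_last.
Qed.

Hypothesis treeV : is_tree adj.

Let adjC : symmetric adj. Proof. by case: treeV. Qed.
Let adj_neq x y : adj x y -> x != y.
Proof. by case: treeV => _ irr _ _; apply: contraTneq => ->; rewrite irr. Qed.

Lemma linked_sym m x y : linked m x y = linked m y x.
Proof.
suff im u v : linked m u v -> linked m v u by apply/idP/idP; apply: im.
move=> l; rewrite /linked (linked_neqr l) /=.
case/andP: l => _; rewrite sym_connect_sym //.
by move=> a b /=; rewrite adjC andbCA.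
Qed.

Lemma tree_path x y :
  exists p, [/\ path adj x p, uniq (x :: p) & last x p = y].
Proof.
case: treeV => _ _ /(_ x y)/connectP[q xq ->] _.
by case/shortenP: xq => p; exists p.
Qed.

(** A path from a to c that avoids m would close up into a cycle through m. *)
Lemma linked_neighbours m a c :
  adj m a -> adj m c -> linked m a c -> a = c.
Proof.
move=> ma mc /linkedP[p [ap up pc mp]].
apply/eqP; apply: contraT => ac.
case: treeV => _ _ _ /(_ (m :: a :: p)) []; last first.
  apply/andP; split; last by rewrite cons_uniq mp.
  by rewrite /= ma rcons_path ap pc adjC.
by case: p pc {ap up mp} => //= e; rewrite e eqxx in ac.
Qed.

(** Deleting the edge mn leaves two components, that of m and that of n. A
    path from m to x either avoids n or contains a path from n to x avoiding m,
    and if there were paths of both kinds, they would close up, through n, into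
    a cycle containing the edge mn. *)
Lemma edge_cut m n x : adj m n -> linked n m x = ~~ linked m n x.
Proof.
move=> mn; have nm : adj n m by rewrite adjC.
apply/idP/idP => [lm|].
  (* b is the neighbour of n on a path from n to x that avoids m. *)
  apply/negP => /linkedP[[|b p] [/= np up px mp]].
    by move: (linked_neqr lm); rewrite -px eqxx.
  case/andP: np => nb bp; case/andP: up => nNp _.
  have lb : linked n b x by rewrite -px; apply: linked_path.
  have mb : m = b.
    apply: linked_neighbours nm nb _.
    by apply: linked_trans lm _; rewrite linked_sym.
  by rewrite mb !inE eqxx orbT in mp.
case: (tree_path m x) => p [mp up <-].
have [nNp /negP[]|np _] := boolP (n \in p).
  case/path.splitP: nNp mp up => p1 p2.
  rewrite cat_path last_cat last_rcons => /andP[_ np] /andP[].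
  rewrite mem_cat mem_rcons inE !negb_or => /andP[/andP[mNn _] mNp] _.
  by apply: linked_path => //; rewrite inE negb_or mNn.
apply: linked_path => //; rewrite inE negb_or np andbT eq_sym.
exact: adj_neq.
Qed.

(** Start from u, which separates itself from v and w, and move towards v and w
    as long as they lie on the same side. The extremal choice replacing this
    walk is a vertex m separating u from v and from w for which the component
    of u in the tree without m is as large as possible. *)
Lemma tree_median u v w :
  exists m, [/\ ~~ linked m u v, ~~ linked m u w & ~~ linked m v w].
Proof.
have u0 : ~~ linked u u v && ~~ linked u u w by rewrite /linked eqxx.
case: (@arg_maxnP _ u (fun m => ~~ linked m u v && ~~ linked m u w)
  (fun m => #|[set x | linked m u x]%SET|) u0) => m /andP[muv muw] max_m.
exists m; split=> //; apply/negP => mvw.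
have vm : v != m by case/andP: mvw.
(* If m did not separate v from w, the neighbour n of m in their common
   direction would be a better choice: the component of u grows, at least by m. *)
case: (tree_path m v) => [[|n p] [/= mp up pv]].
  by rewrite pv eqxx in vm.
case/andP: mp => mn np; case/andP: up => mNp _.
have mnv : linked m n v by rewrite -pv; apply: linked_path.
have mnw : linked m n w := linked_trans mnv mvw.
have mun x : linked m n x -> linked m u x = false.
  move=> mnx; apply/negP => mux; case/negP: muv.
  by apply: linked_trans mux (linked_trans _ mnv); rewrite linked_sym.
have nmu : linked n m u.
  rewrite edge_cut //; apply/negP => mnu; move: (mun u mnu).
  by rewrite linked_refl (linked_neqr mnu).
have far x : linked m n x -> ~~ linked n u x.
  move=> mnx; apply/negP => nux.
  by move: (linked_trans nmu nux); rewrite edge_cut // mnx.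
have := max_m n; rewrite !far //= => /(_ isT); apply/negP; rewrite -ltnNge.
apply: proper_card; apply/properP; split; last first.
  exists m; rewrite !inE; first by rewrite linked_sym.
  by apply/negP => /linked_neqr; rewrite eqxx.
apply/fintype.subsetP => x; rewrite !inE => mux.
apply: (@linked_trans n m u); first by rewrite linked_sym.
by rewrite edge_cut //; apply: contraTN mux => /mun ->.
Qed.

End Linked.

(** * The tree metric *)

Section Distances.
Local Open Scope ring_scope.
Variables (R : realType) (V : finType) (adj : rel V) (len : edge adj -> R).
Hypothesis treeV : is_tree adj.
Hypothesis len_ge0 : forall e, 0 <= len e.

Local Notation step := (step_length len).
Local Notation walk := (walk_length len).
Local Notation d := (vertex_dist len).

Lemma step_length_ge0 u v : 0 <= step u v.
Proof. by apply: sumr_ge0. Qed.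

Lemma step_lengthC u v : step u v = step v u.
Proof. by apply: eq_bigl => e; rewrite /joins orbC. Qed.

Lemma le_step_length e u v : joins e u v -> len e <= step u v.
Proof.
move=> euv; rewrite /step_length (bigD1 e) //= lerDl.
by apply: sumr_ge0.
Qed.

Lemma walk_length_nil u : walk u [::] = 0.
Proof. by rewrite /walk_length big_nil. Qed.

Lemma walk_length_cons u v s : walk u (v :: s) = step u v + walk v s.
Proof. by rewrite /walk_length /= big_cons. Qed.

Lemma walk_length_ge0 u s : 0 <= walk u s.
Proof.
elim: s u => [|v s IHs] u; first by rewrite walk_length_nil.
by rewrite walk_length_cons addr_ge0 ?step_length_ge0.
Qed.

Lemma vertex_dist_le_walk u s : path adj u s -> d u (last u s) <= walk u s.
Proof.
move=> us; apply: ge_inf; last by exists s.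
by exists 0 => _ [q _ <-]; apply: walk_length_ge0.
Qed.

Lemma le_vertex_dist u v r :
  (forall s, path adj u s -> last u s = v -> r <= walk u s) -> r <= d u v.
Proof.
move=> le_r; apply: lb_le_inf; last by move=> _ [s [us sv] <-]; apply: le_r.
have [s [us _ sv]] := tree_path treeV u v.
by exists (walk u s); exists s.
Qed.

Lemma vertex_dist_ge0 u v : 0 <= d u v.
Proof. by apply: le_vertex_dist => s _ _; apply: walk_length_ge0. Qed.

Lemma vertex_distxx u : d u u = 0.
Proof.
apply/eqP; rewrite eq_le vertex_dist_ge0 andbT.
by have := @vertex_dist_le_walk u [::] isT; rewrite walk_length_nil.
Qed.

Lemma vertex_dist_adj u v : adj u v -> d u v <= step u v.
Proof.
move=> uv; have := @vertex_dist_le_walk u [:: v].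
by rewrite /= uv walk_length_cons walk_length_nil addr0 => /(_ isT).
Qed.

Lemma vertex_dist_step u v w : adj u v -> d u w <= step u v + d v w.
Proof.
move=> uv; rewrite -lerBlDl; apply: le_vertex_dist => s vs sw.
rewrite lerBlDl -walk_length_cons -sw.
by apply: (@vertex_dist_le_walk u (v :: s)); rewrite /= uv.
Qed.

Lemma vertex_dist_triangle u v w : d u w <= d u v + d v w.
Proof.
rewrite -lerBlDr; apply: le_vertex_dist => s.
elim: s u => [|x s IHs] u /=.
  by move=> _ ->; rewrite walk_length_nil subrr.
case/andP=> ux xs sv; rewrite walk_length_cons.
have := vertex_dist_step w ux; have := IHs x xs sv; lra.
Qed.

Lemma vertex_distC u v : d u v = d v u.
Proof.
suff le_d x y : d x y <= d y x by apply/eqP; rewrite eq_le !le_d.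
apply: le_vertex_dist => s; elim: s y => [|z s IHs] y /=.
  by move=> _ ->; rewrite vertex_distxx walk_length_nil.
case/andP=> yz zs sx; rewrite walk_length_cons step_lengthC.
have zy : adj z y by case: treeV => /(_ z y) ->.
have := vertex_dist_triangle x z y; have := vertex_dist_adj zy.
have := IHs z zs sx; lra.
Qed.

(** Every walk from u to v visits m, so it can be cut there into a walk from
    u to m and a walk from m to v. *)
Lemma vertex_dist_separated m u v :
  ~~ linked adj m u v -> d u m + d m v <= d u v.
Proof.
move=> muv; apply: le_vertex_dist => s us sv.
elim: s u us sv muv => [|x s IHs] u /=.
  move=> _ ->; rewrite linked_refl negbK => /eqP ->.
  by rewrite !vertex_distxx walk_length_nil addr0.
case/andP=> ux xs sv muv.
have [um|um] := eqVneq u m.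
  rewrite -um vertex_distxx add0r -sv.
  by apply: (@vertex_dist_le_walk u (x :: s)); rewrite /= ux.
have mxv : ~~ linked adj m x v.
  have [->|xm] := eqVneq x m; first by rewrite /linked eqxx.
  by apply: contraNN muv; apply: linked_trans; apply: linked_adj.
rewrite walk_length_cons.
have := IHs x xs sv mxv; have := vertex_dist_step m ux; lra.
Qed.

(** If u is on the side of m of the edge mn, then every walk from u to n
    crosses this edge from m to n at some step. *)
Lemma vertex_dist_through_edge e m n u :
  joins e m n -> adj m n -> linked adj n m u -> d u m + len e <= d u n.
Proof.
move=> emn mn nmu; apply: le_vertex_dist => s us sn.
elim: s u us sn nmu => [|x s IHs] u /=.
  by move=> _ -> /linked_neqr; rewrite eqxx.
case/andP=> ux xs sn nmu; rewrite walk_length_cons.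
have [nmx|nmx] := boolP (linked adj n m x).
  by have := IHs x xs sn nmx; have := vertex_dist_step m ux; lra.
have xn : x = n.
  apply/eqP; apply: contraNT nmx => xn; apply: (linked_trans nmu).
  by rewrite linked_adj // (linked_neqr nmu).
have um : u = m.
  move: nmu; rewrite (edge_cut treeV) //; apply: contraNeq => um.
  have nm : n != m.
    by case: treeV => _ irr _ _; apply: contraTneq mn => ->; rewrite irr.
  rewrite xn in ux; apply: linked_adj => //.
  by case: treeV => /(_ n u) ->.
rewrite um xn vertex_distxx add0r (le_trans (le_step_length emn)) //.
by rewrite lerDl walk_length_ge0.
Qed.

(** One end of e lies between v and the other end, so along e the distance
    from v increases from the near end to the far end. *)
Lemma dist_edge_le v e t : 0 <= t <= len e ->
  dist len v (inr (e, t)) <= Num.max (d v (val e).1) (d v (val e).2).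
Proof.
move=> /andP[t0 te] /=; case/andP: (valP e); set m := _.1; set n := _.2 => mn _.
have emn : joins e m n by rewrite /joins /m /n -surjective_pairing eqxx.
have nm : adj n m by case: treeV => /(_ n m) ->.
rewrite ge_min !le_max.
have [nmv|] := boolP (linked adj n m v).
  have mv_nv := vertex_dist_through_edge emn mn nmv.
  by apply/orP; left; apply/orP; right; lra.
rewrite (edge_cut treeV _ mn) negbK => mnv.
have enm : joins e n m by rewrite /joins orbC.
have nv_mv := vertex_dist_through_edge enm nm mnv.
by apply/orP; right; apply/orP; left; lra.
Qed.

(** Let m be the median of v, s and t. If m separates x from s, then
    d(s,m) + d(m,x) = d(s,x) <= d(s,t) = d(s,m) + d(m,t), hence
    d(m,x) <= d(m,t) and d(v,x) <= d(v,m) + d(m,t) = d(v,t). Otherwise m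
    separates x from t, and the same holds with s and t exchanged. *)
Lemma diametral_pair (A : {set V}) : (1 < #|A|)%N ->
  exists s t, [/\ s \in A, t \in A, s != t &
    forall v x, x \in A -> d v x <= Num.max (d v s) (d v t)].
Proof.
case/card_gt1P=> s0 [t0 [s0A t0A s0t0]].
pose P (z : V * V) := [&& z.1 \in A, z.2 \in A & z.1 != z.2].
have P0 : P (s0, t0) by rewrite /P /= s0A t0A.
have [[s t] /= /and3P[/= sA tA st] max_st] :=
  @Order.TotalTheory.arg_maxP _ R _ (s0, t0) P (fun z => d z.1 z.2) P0.
(* The maximum was taken over distinct elements only, to make sure that s and
   t differ even when all lengths vanish. *)
have {}max_st x y : x \in A -> y \in A -> d x y <= d s t.
  move=> xA yA; have [->|xy] := eqVneq x y.
    by rewrite vertex_distxx vertex_dist_ge0.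
  by apply: (max_st (x, y)); rewrite /P /= xA yA.
exists s, t; split=> // v x xA.
have [m [mvs mvt mst]] := tree_median treeV v s t.
have vx := vertex_dist_triangle v m x.
have stm := vertex_dist_triangle s m t.
have vs := vertex_dist_separated mvs; have vt := vertex_dist_separated mvt.
have [msx|msx] := boolP (linked adj m s x); last first.
  have := vertex_dist_separated msx; have := max_st s x sA xA => *.
  by rewrite le_max; apply/orP; right; lra.
have mxt : ~~ linked adj m x t.
  by apply: contraNN mst; apply: linked_trans.
have := vertex_dist_separated mxt; have := max_st x t xA tA => xt.
rewrite le_max (vertex_distC x m) => *; apply/orP; left.
by rewrite (vertex_distC s m) in stm; lra.
Qed.

End Distances.

(** * Maxians and pairs *)

Section Maxians.
Local Open Scope ring_scope.
Variables (R : realType) (V : finType) (adj : rel V) (len : edge adj -> R).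
Variable w : V -> R.
Hypothesis treeV : is_tree adj.
Hypothesis len_ge0 : forall e, 0 <= len e.
Hypothesis w_ge0 : forall v, 0 <= w v.

Local Notation d := (vertex_dist len).
Local Notation F := (maxian_value len w).
Local Notation vpts := (@vertex_points R V adj).
Local Notation far X v :=
  (\big[Num.max/0]_(x <- (X : {fset Defs.point R adj})) dist len v x).

Lemma le_maxian_value (X Y : {fset Defs.point R adj}) :
  (forall v x, x \in X -> dist len v x <= far Y v) -> F X <= F Y.
Proof.
move=> le_XY; apply: ler_sum => v _; apply: ler_wpM2l => //.
by rewrite big_seq bigmax_le ?bigmax_ge_id // => x /le_XY.
Qed.

Lemma mem_vertex_points (A : {set V}) x :
  (x \in vpts A) = if x is inl v then v \in A else false.
Proof.
apply/imfsetP/idP => [[v /= vA ->] // |].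
by case: x => // v vA; exists v.
Qed.

Lemma vertex_points_point_set (A : {set V}) : point_set len #|A| (vpts A).
Proof.
split; last by move=> x; rewrite mem_vertex_points; case: x.
rewrite card_imfset /=; last by move=> u v [].
by rewrite cardE.
Qed.

Lemma maxian_value_subset (A B : {set V}) :
  A \subset B -> F (vpts A) <= F (vpts B).
Proof.
move=> /fintype.subsetP AB; apply: le_maxian_value => v x.
rewrite mem_vertex_points; case: x => // u uA.
by apply: le_bigmax_seq => //; rewrite mem_vertex_points AB.
Qed.

Lemma le_maxian_value_pair (X : {fset Defs.point R adj}) (s t : V) :
  (forall v x, x \in X -> dist len v x <= Num.max (d v s) (d v t)) ->
  F X <= F (vpts [set s; t]%SET).
Proof.
move=> le_st; apply: le_maxian_value => v x /le_st/le_trans; apply.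
have le_far u : u \in [set s; t]%SET -> d v u <= far (vpts [set s; t]%SET) v.
  move=> ust; apply: (@le_bigmax_seq _ _ _ _ _ (inl u) predT) => //.
  by rewrite mem_vertex_points.
by rewrite ge_max !le_far // !inE eqxx ?orbT.
Qed.

Lemma maxian_value_diametral_pair (A : {set V}) : (1 < #|A|)%N ->
  exists2 B : {set V}, (B \subset A) && (#|B| == 2%N) & F (vpts A) <= F (vpts B).
Proof.
move=> A2; have [s [t [sA tA st max_st]]] := diametral_pair treeV len_ge0 A2.
exists [set s; t]%SET.
  by rewrite cards2 st finset.subUset !finset.sub1set sA tA.
apply: le_maxian_value_pair => v x.
by rewrite mem_vertex_points; case: x => // u /(max_st v).
Qed.

(** The pair is a diametral pair of the whole tree. *)
Lemma maxian_value_le_vertex_pair : (1 < #|V|)%N ->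
  exists2 B : {set V}, #|B| = 2%N &
    forall X : {fset Defs.point R adj},
      {in X, forall x, in_tree len x} -> F X <= F (vpts B).
Proof.
move=> V1; have V2 : (1 < #|[set: V]%SET|)%N by rewrite cardsT.
have [s [t [_ _ st max_st]]] := diametral_pair treeV len_ge0 V2.
exists [set s; t]%SET => [|X Xin]; first by rewrite cards2 st.
apply: le_maxian_value_pair => v x xX.
case: x xX => [u _|[e r] xX]; first by apply: max_st; rewrite finset.in_setT.
have /andP[r0 re] : 0 < r < len e := Xin _ xX.
apply: le_trans (dist_edge_le treeV len_ge0 _ _) _; first by rewrite !ltW.
by rewrite ge_max !max_st ?finset.in_setT.
Qed.

Lemma extend_set (A : {set V}) k : (#|A| <= k <= #|V|)%N ->
  exists2 B : {set V}, A \subset B & #|B| = k.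
Proof.
elim: k => [|k IHk] /andP[]; first by exists A => //; apply/eqP; rewrite -leqn0.
rewrite leq_eqVlt => /predU1P[<- _|Ak kV]; first by exists A.
have [|B AB Bk] := IHk; first by rewrite -ltnS Ak ltnW.
have [x xB] : exists x, x \in ~: B.
  by apply/card_gt0P; rewrite cardsCs finset.setCK Bk subn_gt0.
exists (x |: B); first exact: fintype.subset_trans (finset.subsetUr _ _).
by rewrite cardsU1 Bk; rewrite inE in xB; rewrite xB.
Qed.

(** If S is a maxian, its value is at least that of a set of #|S| vertices
    containing the best vertex pair B; a diametral pair of S has the
    same value as S, so it is optimal among pairs. Conversely S is at least as
    good as any optimal pair it contains, hence as good as B, which no set of
    points exceeds. *)
Theorem maxian_iff_pair (S : {set V}) : (1 < #|S|)%N ->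
  is_maxian len w #|S| (vpts S) <->
  exists2 A, A \in pairs_in S & is_maxian len w 2%N (vpts A).
Proof.
move=> S2.
have SV : (#|S| <= #|V|)%N by apply: max_card.
have [B B2 topB] := maxian_value_le_vertex_pair (leq_trans S2 SV).
split=> [[_ maxS]|[A AS [_ maxA]]].
  have [A /andP[AS /eqP A2] leSA] := maxian_value_diametral_pair S2.
  have [|C BC CS] := @extend_set B #|S|; first by rewrite B2 S2 SV.
  exists A; first by rewrite inE AS A2.
  rewrite -A2; split; first exact: vertex_points_point_set.
  move=> Y [_ /topB/le_trans]; apply.
  apply: le_trans (maxian_value_subset BC) _.
  apply: le_trans leSA; apply: maxS.
  by rewrite -CS; apply: vertex_points_point_set.
split; first exact: vertex_points_point_set.
move: AS; rewrite inE => /andP[AS _].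
move=> Y [_ /topB/le_trans]; apply; apply: le_trans (maxian_value_subset AS).
by apply: maxA; rewrite -B2; apply: vertex_points_point_set.
Qed.

End Maxians.

(** * Reduction of the inverse problem *)

Lemma inverse_feasible_iff_pair (R : realType) (V : finType) (adj : rel V)
    (I : inverse_data R adj) (S : {set V}) x :
  is_tree adj -> nonneg_data I -> (1 < #|S|)%N ->
  inverse_feasible I #|S| S x <->
  exists2 A, A \in pairs_in S & inverse_feasible I 2%N A x.
Proof.
move=> treeV [w_ge0 _ _ _] S2.
split=> [[x1 x2 len_ge0 maxS]|[A AS [x1 x2 len_ge0 maxA]]].
  by case/(maxian_iff_pair treeV len_ge0 w_ge0 S2): maxS => A AS maxA; exists A.
split=> //; apply/(maxian_iff_pair treeV len_ge0 w_ge0 S2).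
by exists A.
Qed.

Section Cheapest.
Local Open Scope ring_scope.
Variables (R : realType) (V : finType) (adj : rel V) (I : inverse_data R adj).
Variable P : {set {set V}}.

Lemma cheapest_exists (sol : {set V} -> option (@modification R V adj)) :
  exists o, cheapest I P sol o.
Proof.
pose hit A := (A \in P) && isSome (sol A).
have [/existsP[A0 A0P]|none] := boolP [exists A, hit A]; last first.
  exists None => B BP; case solB: (sol B) => //.
  by case/existsP: none; exists B; rewrite /hit BP solB.
pose c A := if sol A is Some x then total_cost I x else 0.
have [A /andP[AP solA] minA] :=
  @Order.TotalTheory.arg_minP _ R _ A0 hit c A0P.
case E: (sol A) solA => [x|] // _; exists (Some x); split; first by exists A.
move=> B y BP solB; have := minA B; rewrite /hit BP solB /c E solB; exact.
Qed.

Variables (k : nat) (S : {set V}).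
(* The feasible set is the union of the feasible sets of the subproblems. *)
Hypothesis feasible_split : forall x,
  inverse_feasible I k S x <-> exists2 A, A \in P & inverse_feasible I 2%N A x.

Lemma cheapest_solves (sol : {set V} -> option (@modification R V adj)) o :
  (forall A, A \in P -> solves I 2%N A (sol A)) ->
  cheapest I P sol o -> solves I k S o.
Proof.
move=> solP; case: o => [x [[A AP solA] minx]|none] /=; last first.
  case=> x /feasible_split[A AP Ax]; have := solP A AP.
  by rewrite none //; apply; exists x.
have := solP A AP; rewrite solA => -[Ax _].
split; first by apply/feasible_split; exists A.
move=> y /feasible_split[B BP By]; have := solP B BP.
case solB: (sol B) => [z|] /=; last by case; exists y.
by case=> _ /(_ y By); apply: le_trans; apply: minx solB.
Qed.

Lemma optimal_cheapest x : inverse_optimal I k S x ->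
  (exists2 A, A \in P & inverse_optimal I 2%N A x) /\
  (forall B y, B \in P -> inverse_optimal I 2%N B y ->
     total_cost I x <= total_cost I y).
Proof.
case=> /feasible_split[A AP Ax] minx.
have minP B y : B \in P -> inverse_feasible I 2%N B y ->
    total_cost I x <= total_cost I y.
  by move=> BP By; apply: minx; apply/feasible_split; exists B.
split; last by move=> B y BP [By _]; apply: minP By.
by exists A => //; split=> // y; apply: minP.
Qed.

End Cheapest.

Theorem mainTheorem5 (R : realType) (V : finType) (adj : rel V)
    (I : inverse_data R adj) (p : nat) (S : {set V}) :
  is_tree adj ->
  nonneg_data I ->
  (2 <= p)%N ->
  #|S| = p ->
  (forall v, v \in S -> leaf adj v) ->
  [/\ (* there are at most p^2 subproblems *)
      (#|pairs_in S| <= p ^ 2)%N,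
      (* a cheapest one among their solutions solves the p-maxian problem *)
      forall sol : {set V} -> option (@modification R V adj),
        (forall A, A \in pairs_in S -> solves I 2 A (sol A)) ->
        (exists o, cheapest I (pairs_in S) sol o) /\
        (forall o, cheapest I (pairs_in S) sol o -> solves I p S o)
    & (* every optimal solution of the p-maxian problem arises in this way *)
      forall x, inverse_optimal I p S x ->
        (exists2 A, A \in pairs_in S & inverse_optimal I 2 A x) /\
        (forall B y, B \in pairs_in S -> inverse_optimal I 2 B y ->
           (total_cost I x <= total_cost I y)%R)].
Proof.
move=> treeV I_ge0 S2 pS _; subst p.
have feas x := inverse_feasible_iff_pair x treeV I_ge0 S2.
split.
- rewrite cards_draws bin2 -divn2 (leq_trans (leq_div _ _)) //.
  by rewrite -mulnn leq_mul // leq_pred.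
- move=> sol solP; split; first exact: cheapest_exists.
  by move=> o; apply: cheapest_solves.
- by move=> x; apply: optimal_cheapest.
Qed.
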